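(* For every unary conjunctive grammar $G=(N,\{c\},R)$, one can construct in polynomial time a $\mathcal{TEL}^{\bigcirc}_{\mathit{future}}$-TBox $\mathcal{T}_G$ and a concept name $A$ occurring in $\mathcal{T}_G$ such that for every nonterminal $\mathcal{B}\in N$ there is a concept name $B$ occurring in $\mathcal{T}_G$ such that for all $n\in\mathbb{N}$: $\mathcal{T}_G\models A\sqsubseteq\bigcirc^nB$ if and only if $c^n\in L_G(\mathcal{B})$.
   Context: A $\mathcal{TEL}^{\bigcirc}$-TBox is a finite set of concept inclusions $A\sqsubseteq\bigcirc^nB$, $A\sqcap A'\sqsubseteq B$, $\exists r.A\sqsubseteq B$, $A\sqsubseteq\exists r.B$ ($A,A',B$ concept names, $r$ a role name, rigid or local, $n\in\mathbb{Z}$); it is a $\mathcal{TEL}^{\bigcirc}_{\mathit{future}}$-TBox if all $n\ge0$. Semantics: an interpretation is a family $(\mathcal{I}_i)_{i\in\mathbb{Z}}$ of classical DL interpretations over a common domain, rigid roles interpreted identically at all $i$; $(\bigcirc^nA)^{i}=A^{i+n}$, $\sqcap$ is intersection, $(\exists r.A)^i=\{d\mid\exists e\in A^i,(d,e)\in r^i\}$; $C\sqsubseteq D$ holds if $C^i\subseteq D^i$ for all $i$; $\models$ is entailment. Sizes count integers in unary. A conjunctive grammar is $G=(N,\Sigma,R)$ with rules $\mathcal{N}\to\alpha_1\&\dots\&\alpha_n$ ($n\ge1$, $\alpha_i\in(N\cup\Sigma)^*$); $L_G(X)$ is the set of $w$ such that $X(w)$ is derivable from axioms $c(c)$ ($c\in\Sigma$)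 by: for each rule with $\alpha_i=X^i_1\cdots X^i_{k_i}$ and words $u^i_j$ with $u^i_1\cdots u^i_{k_i}=w$ for every $i$, infer $\mathcal{N}(w)$ from all $X^i_j(u^i_j)$. Unary means $\Sigma=\{c\}$. *)

(* Defs.v *)
From Stdlib Require List.
From mathcomp Require Import all_boot all_order all_algebra.

Set Implicit Arguments.
Unset Strict Implicit.
Unset Printing Implicit Defensive.

Import Order.TTheory GRing.Theory Num.Theory.

(** * Temporal EL *)

Definition cname := nat.

(* The boolean tells whether the role name is rigid ([true]) or local; there
   are infinitely many names of each kind. *)
Definition role : Type := bool * nat.
Definition is_rigid (r : role) : bool := r.1.

Inductive concept :=
  | Name of cname
  | Next of int & cname
  | And of cname & cname
  | Exists of role & cname.

Inductive inclusion :=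
  | SubNext of cname & int & cname           (* A [= O^n B      *)
  | SubAnd of cname & cname & cname          (* A /\ A' [= B    *)
  | SubExL of role & cname & cname           (* exists r.A [= B *)
  | SubExR of cname & role & cname.          (* A [= exists r.B *)

Definition lhs (ci : inclusion) : concept :=
  match ci with
  | SubNext A _ _ => Name A
  | SubAnd A A' _ => And A A'
  | SubExL r A _ => Exists r A
  | SubExR A _ _ => Name A
  end.

Definition rhs (ci : inclusion) : concept :=
  match ci with
  | SubNext _ n B => Next n B
  | SubAnd _ _ B => Name B
  | SubExL _ _ B => Name B
  | SubExR _ r B => Exists r B
  end.

Definition tbox := seq inclusion.

Definition future_inclusion (ci : inclusion) : bool :=
  if ci is SubNext _ n _ then (0 <= n)%R else true.

Definition future_tbox (T : tbox) : bool := all future_inclusion T.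

Definition inclusion_cnames (ci : inclusion) : seq cname :=
  match ci with
  | SubNext A _ B => [:: A; B]
  | SubAnd A A' B => [:: A; A'; B]
  | SubExL _ A B => [:: A; B]
  | SubExR A _ B => [:: A; B]
  end.

Definition occurs (A : cname) (T : tbox) : bool :=
  has (fun ci => A \in inclusion_cnames ci) T.

Record interp := Interp {
  dom : Type;
  dom_inhabited : inhabited dom;
  cint : int -> cname -> dom -> Prop;
  rint : int -> role -> dom -> dom -> Prop;
  rint_rigid : forall r, is_rigid r ->
    forall i j d e, rint i r d e <-> rint j r d e
}.

Definition ceval (I : interp) (i : int) (C : concept) (d : dom I) : Prop :=
  match C with
  | Name A => cint i A d
  | Next n A => cint (i + n)%R A d
  | And A A' => cint i A d /\ cint i A' d
  | Exists r A => exists e : dom I, cint i A e /\ rint i r d e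
  end.

Definition satisfies (I : interp) (ci : inclusion) : Prop :=
  forall (i : int) (d : dom I), ceval i (lhs ci) d -> ceval i (rhs ci) d.

Definition model (I : interp) (T : tbox) : Prop :=
  forall ci, List.In ci T -> satisfies I ci.

Definition entails (T : tbox) (ci : inclusion) : Prop :=
  forall I : interp, model I T -> satisfies I ci.

(** * Conjunctive grammars *)

(* The nonterminals are numbered: N = {0, ..., num_nt - 1}. A rule
   X -> alpha_1 & ... & alpha_n is the pair (X, [:: alpha_1; ...; alpha_n]). *)
Record cgrammar (S : finType) := CGrammar {
  num_nt : nat;
  rules : seq ('I_num_nt * seq (seq ('I_num_nt + S)));
  rules_nonempty : all (fun rl => 0 < size rl.2) rules
}.

Definition nonterminal (S : finType) (G : cgrammar S) : Type := 'I_(num_nt G).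

(* In [derives_rule], the i-th sequence of [uss] is the factorization
   u^i_1, ..., u^i_{k_i} of w matching alpha_i; equality of shapes makes
   the zip below pair every X^i_j with u^i_j. *)
Inductive derives (S : finType) (G : cgrammar S) :
    'I_(num_nt G) + S -> seq S -> Prop :=
  | derives_axiom (c : S) : derives (inr c) [:: c]
  | derives_rule (X : 'I_(num_nt G)) (alphas : seq (seq ('I_(num_nt G) + S)))
      (uss : seq (seq (seq S))) (w : seq S) :
      (X, alphas) \in rules G ->
      shape uss = shape alphas ->
      (forall us, us \in uss -> flatten us = w) ->
      (forall p, p \in zip (flatten alphas) (flatten uss) ->
         derives p.1 p.2) ->
      derives (inl X) w.

Definition lang (S : finType) (G : cgrammar S) (X : nonterminal G)
  (w : seq S) : Prop := derives (inl X) w.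

Definition unary_cgrammar := cgrammar unit.

(** * Polynomial-time computability: deterministic multitape Turing machines *)

Inductive move := MoveL | MoveN | MoveR.

Definition shift (m : move) : int :=
  match m with MoveL => (-1)%R | MoveN => 0%R | MoveR => 1%R end.

(* A cell is blank ([None]), or holds a bit or an auxiliary work symbol. *)
Definition cell (W : finType) : Type := option (bool + W).

(* There are [tm_k.+2] two-way infinite tapes: the first one carries the
   input and the last one the output. The machine halts on [None]. *)
Record machine := Machine {
  tm_k : nat;
  tm_state : finType;
  tm_work : finType;
  tm_start : tm_state;
  tm_delta : tm_state -> {ffun 'I_tm_k.+2 -> cell tm_work} ->
    option (tm_state * ('I_tm_k.+2 -> cell tm_work * move))
}.

Record config (M : machine) := Config {
  cf_state : tm_state M;
  cf_head : 'I_(tm_k M).+2 -> int;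
  cf_tape : 'I_(tm_k M).+2 -> int -> cell (tm_work M)
}.

Definition tape_of (W : finType) (w : seq bool) (x : int) : cell W :=
  if x is Posz n then nth None [seq Some (inl b) | b <- w] n else None.

Definition init_config (M : machine) (w : seq bool) : config M :=
  Config (tm_start M) (fun _ => 0%R)
    (fun j => if j == ord0 then tape_of (tm_work M) w else fun _ => None).

Definition step (M : machine) (c : config M) : option (config M) :=
  omap (fun qa : tm_state M * ('I_(tm_k M).+2 -> cell (tm_work M) * move) =>
      Config qa.1
        (fun j => (cf_head c j + shift (qa.2 j).2)%R)
        (fun j x => if x == cf_head c j then (qa.2 j).1 else cf_tape c j x))
    (tm_delta (cf_state c) [ffun j => cf_tape c j (cf_head c j)]).

Definition computes_in (M : machine) (w : seq bool) (t : nat) (v : seq bool) :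
    Prop :=
  exists c : config M,
    [/\ iter t (obind (@step M)) (Some (init_config M w)) = Some c,
        step c = None
      & forall x : int, cf_tape c ord_max x = tape_of (tm_work M) v x].

Definition poly_time (X Y : Type) (encX : X -> seq bool) (encY : Y -> seq bool)
    (f : X -> Y) : Prop :=
  exists (M : machine) (p : {poly nat}), forall x : X,
    exists2 t : nat, (t <= p.[size (encX x)]%R)%N
      & computes_in M (encX x) t (encY (f x)).

(** * Prefix-free binary encodings

   All numbers are in unary. For the indices of nonterminals this costs at most
   a factor [num_nt G], itself written in unary, i.e., N is listed. *)

Definition enc_nat (n : nat) : seq bool := rcons (nseq n true) false.

Definition enc_int (z : int) : seq bool :=
  match z with Posz n => false :: enc_nat n | Negz n => true :: enc_nat n end.

Definition enc_seq (X : Type) (enc : X -> seq bool) (s : seq X) : seq bool :=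
  rcons (flatten [seq true :: enc x | x <- s]) false.

Definition enc_symbol (k : nat) (x : 'I_k + unit) : seq bool :=
  match x with inl X => true :: enc_nat X | inr _ => [:: false] end.

Definition enc_rule (k : nat) (rl : 'I_k * seq (seq ('I_k + unit))) :
    seq bool :=
  enc_nat rl.1 ++ enc_seq (enc_seq (@enc_symbol k)) rl.2.

Definition enc_grammar (G : unary_cgrammar) : seq bool :=
  enc_nat (num_nt G) ++ enc_seq (@enc_rule (num_nt G)) (rules G).

Definition enc_role (r : role) : seq bool := r.1 :: enc_nat r.2.

Definition enc_inclusion (ci : inclusion) : seq bool :=
  match ci with
  | SubNext A n B =>
      [:: false; false] ++ enc_nat A ++ enc_int n ++ enc_nat B
  | SubAnd A A' B =>
      [:: false; true] ++ enc_nat A ++ enc_nat A' ++ enc_nat B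
  | SubExL r A B =>
      [:: true; false] ++ enc_role r ++ enc_nat A ++ enc_nat B
  | SubExR A r B =>
      [:: true; true] ++ enc_nat A ++ enc_role r ++ enc_nat B
  end.

Definition enc_tbox_name (TA : tbox * cname) : seq bool :=
  enc_seq enc_inclusion TA.1 ++ enc_nat TA.2.

(* Main.v *)
From Stdlib Require Import FunctionalExtensionality.
Require Import Defs.
From mathcomp Require Import all_boot all_order all_algebra.
From mathcomp Require Import zify.

(** Call an instance of A a start at time [i]. A symbol x holds at [i + n] of
    every start at [i] exactly when c^n is derivable from x. For the factors
    x_1 ... x_k of a conjunct, the prefix concepts P_0, ..., P_k hold at the
    lengths of the words of x_1 ... x_j: where P_(j-1) holds, a rigid role
    leads to a new start, and once this start satisfies x_j, rigidity carries
    the information back as P_j at the original element. The conjuncts of a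
    rule are then intersected. Conversely, a TBox of this shape has a model over
    the integers in which k' is the start born at time k', and B holds of k at
    time [k + n] iff n belongs to the language assigned to B.

    The TBox is emitted while the grammar is read once from left to right, with
    the next fresh name held in a counter. This is a program over three
    counters, compiled to a Turing machine. The fresh name never exceeds the
    number of bits read by more than 3, so each bit costs linear time. *)

Set Implicit Arguments.
Unset Strict Implicit.
Unset Printing Implicit Defensive.

Import Order.TTheory GRing.Theory Num.Theory.

(** * The TBox *)

Definition name_A : cname := 0.
Definition name_C : cname := 1.
(* Holds from every start on: the intersection of no conjuncts. *)
Definition name_U : cname := 2.

Definition symbol_name (k : nat) (x : 'I_k + unit) : cname :=
  if x is inl X then X.+3 else name_C.

Section Construction.
Variable k : nat.
Implicit Types (al : seq ('I_k + unit)) (als : seq (seq ('I_k + unit))).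

(** A prefix concept and the rigid role used at its end share the number [f], so that a single
    counter of fresh names serves both. *)
Fixpoint word_incls (f : cname) al : tbox :=
  if al is x :: al' then
    SubExR f (true, f) name_A :: SubExL (true, f) (symbol_name x) f.+1
      :: word_incls f.+1 al'
  else [::].

(* Fresh names start at [f]; [d] stands for the intersection of [als]. *)
Fixpoint body_incls (f d : cname) als : tbox :=
  if als is al :: als' then
    SubNext name_A (Posz 0) f :: word_incls f al ++
      SubAnd (f + size al) (f + size al).+1 d
      :: body_incls (f + size al).+2 (f + size al).+1 als'
  else [:: SubNext name_U (Posz 0) d].

(** Per conjunct: one name for each prefix, the empty one included, and one for the intersection of
    the later conjuncts. *)
Definition body_width als : nat := sumn [seq (size al).+2 | al <- als].

Fixpoint rules_incls (f : cname) (rls : seq ('I_k * seq (seq ('I_k + unit)))) :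
    tbox :=
  if rls is rl :: rls' then
    SubNext f (Posz 0) rl.1.+3 :: body_incls f.+1 f rl.2 ++
      rules_incls (f + body_width rl.2).+1 rls'
  else [::].

End Construction.

Definition base_incls : tbox :=
  [:: SubNext name_A (Posz 1) name_C; SubNext name_A (Posz 0) name_U;
      SubNext name_U (Posz 1) name_U].

(** Tautologies, whose purpose is that the name of every nonterminal occurs in the TBox, even if the
    nonterminal appears in no rule. *)
Definition nt_incls (f n : nat) : tbox :=
  [seq SubNext B (Posz 0) B | B <- iota f n].

Definition grammar_tbox (G : unary_cgrammar) : tbox :=
  base_incls ++ nt_incls 3 (num_nt G) ++ rules_incls (num_nt G).+3 (rules G).

Lemma grammar_tbox_future G : future_tbox (grammar_tbox G).
Proof.
have bodyF k f d (als : seq (seq ('I_k + unit))) :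
    future_tbox (body_incls f d als).
  elim: als f d => [|al als IH] f d //=.
  rewrite /future_tbox all_cat /=; apply/andP; split; last exact: IH.
  by elim: al f {IH} => //= x al IH f; exact: IH.
rewrite /future_tbox !all_cat /=; apply/andP; split.
  by rewrite all_map; apply/allP.
elim: (rules G) (_.+3) => //= rl rls IH f.
by rewrite all_cat IH andbT; exact: bodyF.
Qed.

Lemma In_cat (X : Type) (x : X) s1 s2 :
  List.In x (s1 ++ s2) <-> List.In x s1 \/ List.In x s2.
Proof. exact: List.in_app_iff. Qed.

Lemma grammar_tbox_occurs_nt G (X : nonterminal G) :
  occurs X.+3 (grammar_tbox G).
Proof.
rewrite /occurs !has_cat; apply/orP; right; apply/orP; left.
rewrite /nt_incls has_map; apply/hasP.
exists X.+3; last by rewrite /= !inE eqxx.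
by rewrite mem_iota /= !addSn add0n !ltnS.
Qed.

(** * From derivations to entailment *)

Section Completeness.
Variables (I : interp).
Local Open Scope ring_scope.

Lemma model_cat T1 T2 : model I (T1 ++ T2) <-> model I T1 /\ model I T2.
Proof.
split=> [H|[H1 H2] ci /In_cat[/H1|/H2]//].
by split=> ci Hci; apply: H; apply/In_cat; [left|right].
Qed.

Lemma model_cons ci T : model I (ci :: T) <-> satisfies I ci /\ model I T.
Proof.
split=> [H|[H1 H2] ci' /= [<-|/H2]//].
by split=> [|ci' Hci]; apply: H => /=; [left|right].
Qed.

(** All starts at all times are covered, because each factor is measured from a new start found
    along a role. *)
Definition reaches (B : cname) (n : nat) : Prop :=
  forall (i : int) (d : dom I),
    cint i name_A d -> cint (i + n%:Z) B d.

Lemma word_complete k f (al : seq ('I_k + unit)) (us : seq (seq unit)) n :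
  model I (word_incls f al) -> size us = size al ->
  (forall p, p \in zip al us -> reaches (symbol_name p.1) (size p.2)) ->
  reaches f n -> reaches (f + size al)%N (n + size (flatten us))%N.
Proof.
elim: al us f n => [|x al IH] [|u us] f n //=.
  by rewrite addn0 addn0.
move=> /model_cons[ER /model_cons[EL Hal]] [Hs] H Hf.
rewrite -addSnnS size_cat addnA; apply: IH => //.
  by move=> p Hp; apply: H; rewrite inE Hp orbT.
move=> i d HA; have [e [He Hr]] := ER _ _ (Hf i d HA).
apply: EL; exists e; split; last first.
  (* The edge was obtained where the prefix ends; rigidity moves it to the time where the next
     factor ends. *)
  exact: (proj1 (@rint_rigid I (true, f) isT _ _ _ _) Hr).
rewrite PoszD addrA; apply: (H (x, u)) => //.
by rewrite inE eqxx.
Qed.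

(** Each [SubAnd] joins one conjunct with the intersection of the later ones; [name_U] supplies the
    empty intersection that ends the recursion. *)
Lemma body_complete k f d (als : seq (seq ('I_k + unit)))
    (uss : seq (seq (seq unit))) (w : seq unit) :
  model I (body_incls f d als) -> shape uss = shape als ->
  reaches name_U (size w) ->
  (forall us, us \in uss -> flatten us = w) ->
  (forall p, p \in zip (flatten als) (flatten uss) ->
     reaches (symbol_name p.1) (size p.2)) ->
  reaches d (size w).
Proof.
elim: als uss f d => [|al als IH] [|us uss] f d //=.
  move=> /model_cons[H _] _ HU _ _ i e He.
  by have := H _ _ (HU i e He); rewrite /= addr0.
move=> /model_cons[H0] /model_cat[Hal] /model_cons[HAnd Hals].
move=> [Hs1 Hs2] HU Hw Hz.
rewrite zip_cat // in Hz.
have H1 : reaches (f + size al)%N (size w).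
  rewrite -(Hw us) ?inE ?eqxx // -[size (flatten us)]add0n.
  apply: word_complete => //.
    by move=> p Hp; apply: Hz; rewrite mem_cat Hp.
have H2 : reaches (f + size al).+1%N (size w).
  apply: IH Hals Hs2 HU _ _.
    by move=> us' Hus; apply: Hw; rewrite inE Hus orbT.
  by move=> p Hp; apply: Hz; rewrite mem_cat Hp orbT.
by move=> i e He; apply: (HAnd _ e); split; [apply: H1|apply: H2].
Qed.

Lemma rules_complete k f (rls : seq ('I_k * seq (seq ('I_k + unit)))) X als :
  model I (rules_incls f rls) -> (X, als) \in rls ->
  exists f' d, satisfies I (SubNext d 0 X.+3) /\ model I (body_incls f' d als).
Proof.
elim: rls f => [|rl rls IH] f //= /model_cons[H0] /model_cat[H1 H2].
rewrite inE => /orP[/eqP E|]; last exact: IH H2.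
by exists f.+1, f; rewrite -E in H0 H1.
Qed.

Lemma grammar_complete (G : unary_cgrammar) x w :
  model I (grammar_tbox G) -> derives x w ->
  reaches (@symbol_name (num_nt G) x) (size w).
Proof.
move=> /model_cat[/model_cons[HC /model_cons[HU /model_cons[HUU _]]]].
move=> /model_cat[_ Hrls]; elim=> {x w} [c i d|X als uss w HX Hs Hw _ IH].
  exact: (HC i d).
have [f [d [Hd Hb]]] := rules_complete Hrls HX.
have HUw : reaches name_U (size w).
  elim: (size w) => [|n IHn] i e He; first exact: (HU i e).
  by rewrite -addn1 PoszD addrA; apply: (HUU _ e); apply: IHn.
move=> i e He; rewrite -[_ + _]addr0; apply: (Hd _ e).
exact: body_complete Hb Hs HUw Hw IH _ _ He.
Qed.

End Completeness.

(** * Models over the integers built from languages *)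

Section Soundness.

Definition language := nat -> Prop.
Implicit Types (L : cname -> language).

Section ShiftModel.
Local Open Scope ring_scope.
Variables (L : cname -> language) (R : role -> language).

(** Membership of [k] at time [i] depends on its age [i - k] only. Roles ignore time, so all of them
    are rigid; an edge is judged by the age of its source when its target is born. *)
Definition shift_model : interp.
Proof.
refine (@Interp int (inhabits 0)
  (fun i B k => exists2 n : nat, i = k + n%:Z & L B n)
  (fun _ r k k' => exists2 n : nat, k' = k + n%:Z & R r n) _).
by [].
Defined.

(** Sufficient conditions on the languages. For [SubExR] the chosen successor is the start born at
    the current time: its age is 0, and the edge to it has length [m]. *)
Definition closed (ci : inclusion) : Prop :=
  match ci with
  | SubNext A (Posz n) B => forall m, L A m -> L B (m + n)%N
  | SubNext _ (Negz _) _ => False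
  | SubAnd A A' B => forall m, L A m -> L A' m -> L B m
  | SubExL r A B => forall m n, R r m -> L A n -> L B (m + n)%N
  | SubExR A r B => forall m, L A m -> R r m /\ L B 0%N
  end.

Lemma shift_modelP ci : closed ci -> satisfies shift_model ci.
Proof.
case: ci => [A [n|//] B|A A' B|r A B|A r B] H i k /=.
- by case=> m -> /H HB; exists (m + n)%N => //; rewrite PoszD addrA.
- case=> [[m -> Hm] [m' /addrI [<-] Hm']]; exists m => //; exact: H.
- case=> k' [[n -> Hn] [m -> Hm]]; exists (m + n)%N; last exact: H.
  by rewrite PoszD addrA.
- case=> m E /H[Hr HB]; exists i; split; last by exists m.
  by exists 0%N; rewrite ?addr0.
Qed.

(** Element 0 has age 0 at time 0 and age [n] at time [n], so the entailment can be read off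
    there. *)
Lemma entails_closed T A n B :
  (forall ci, List.In ci T -> closed ci) -> L A 0%N ->
  entails T (SubNext A (Posz n) B) -> L B n.
Proof.
move=> HT HA HE.
have HA0 : @ceval shift_model 0 (Name A) 0 by exists 0%N.
have HM : model shift_model T by move=> ci /HT /shift_modelP.
by have [m /addrI [->]] := HE _ HM _ _ HA0.
Qed.

End ShiftModel.


(* The lists [..._langs] below give the languages of consecutive fresh names, in
   the order in which [..._incls] introduces these names. *)
Variables (k : nat) (D : 'I_k -> language).
Implicit Types (al : seq ('I_k + unit)) (als : seq (seq ('I_k + unit))).

Definition symbol_lang (x : 'I_k + unit) : language :=
  if x is inl X then D X else eq 1.

Definition concat_lang (P Q : language) : language :=
  fun n => exists p q, [/\ P p, Q q & n = p + q].

Fixpoint word_langs (P : language) al : seq language :=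
  P :: if al is x :: al' then word_langs (concat_lang P (symbol_lang x)) al'
       else [::].

Definition word_lang (P : language) al : language :=
  foldl (fun Q x => concat_lang Q (symbol_lang x)) P al.

Definition body_lang als : language :=
  fun n => forall al, al \in als -> word_lang (eq 0) al n.

Fixpoint body_langs als : seq language :=
  if als is al :: als' then
    word_langs (eq 0) al ++ body_lang als' :: body_langs als'
  else [::].

Definition rules_langs (rls : seq ('I_k * seq (seq ('I_k + unit)))) :
    seq language :=
  flatten [seq body_lang rl.2 :: body_langs rl.2 | rl <- rls].

Variable dflt : language.

Lemma size_word_langs P al : size (word_langs P al) = (size al).+1.
Proof. by elim: al P => //= x al IH P; rewrite IH. Qed.

Lemma size_body_langs als : size (body_langs als) = body_width als.
Proof.
elim: als => //= al als IH.
by rewrite size_cat /= size_word_langs IH /body_width /= addnS.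
Qed.

Variable L : cname -> language.

Definition agrees (f : cname) (s : seq language) : Prop :=
  forall j, j < size s -> L (f + j) = nth dflt s j.

Lemma agrees_cat f s1 s2 :
  agrees f (s1 ++ s2) -> agrees f s1 /\ agrees (f + size s1) s2.
Proof.
move=> H; split=> j Hj.
  by rewrite H ?nth_cat ?Hj // size_cat ltn_addr.
by rewrite -addnA H ?size_cat ?ltn_add2l // nth_cat ltnNge leq_addr addKn.
Qed.

Lemma agrees_cons f P s : agrees f (P :: s) -> L f = P /\ agrees f.+1 s.
Proof.
move=> H; split=> [|j Hj]; first by rewrite -[f in LHS]addn0 H.
by rewrite addSnnS H.
Qed.

Hypothesis LA : L name_A = eq 0.
Hypothesis LC : L name_C = eq 1.
Hypothesis LD : forall X : 'I_k, L X.+3 = D X.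

(** A role leads from a start to the starts born where the prefix of the same number can end. *)
Let R (r : role) : language := L r.2.

Lemma L_symbol x : L (symbol_name x) = symbol_lang x.
Proof. by case: x. Qed.

Lemma word_closed f P al :
  agrees f (word_langs P al) ->
  (forall ci, List.In ci (word_incls f al) -> closed L R ci) /\
  L (f + size al) = word_lang P al.
Proof.
elim: al f P => [|x al IH] f P.
  by case/agrees_cons => Hf _; split => //=; rewrite addn0.
move=> /agrees_cons[Hf H]; have [H1 H2] := IH _ _ H; rewrite addnS -addSn.
have Hf1 : L f.+1 = concat_lang P (symbol_lang x).
  (* [word_langs] has the same first entry whether [al] is empty or not; the case split only exposes
     it. *)
  by case: (al) H => [|? ?] /agrees_cons[].
split=> // ci /= [<- m Hm|[<- m n Hm Hn|/H1//]].
  by rewrite LA.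
by rewrite Hf1 -Hf; exists m, n; rewrite -L_symbol.
Qed.

Lemma body_closed f d als :
  agrees f (body_langs als) -> L d = body_lang als ->
  forall ci, List.In ci (body_incls f d als) -> closed L R ci.
Proof.
elim: als f d => [|al als IH] f d /=.
  (* [body_lang [::]] contains every length, by vacuity. *)
  by move=> _ Hd ci [<-|//] m _; rewrite Hd.
move=> /agrees_cat[H]; rewrite size_word_langs addnS.
move=> /agrees_cons[Hd' H'] Hd; have [H1 H2] := word_closed H.
have Hf : L f = eq 0 by case: (al) H => [|? ?] /agrees_cons[].
move=> ci [<-|/In_cat[/H1//|[<- m|]]].
- by move=> m; rewrite LA Hf addn0.
- rewrite H2 Hd Hd' => Hal Hals al'; rewrite inE => /orP[/eqP->//|].
  exact: Hals.
- exact: IH.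
Qed.

Lemma rules_closed f (rls : seq ('I_k * seq (seq ('I_k + unit)))) :
  agrees f (rules_langs rls) ->
  (forall X als n, (X, als) \in rls -> body_lang als n -> D X n) ->
  forall ci, List.In ci (rules_incls f rls) -> closed L R ci.
Proof.
elim: rls f => [|[X als] rls IH] f //= /agrees_cat[/agrees_cons[Hf Hb] H] HD.
move=> ci [<-|/In_cat[|]].
- by move=> m; rewrite Hf LD addn0; apply: HD; rewrite inE eqxx.
- exact: body_closed.
- apply: IH; first by move: H; rewrite /= size_body_langs addnS.
  by move=> Y als' n Hin; apply: HD; rewrite inE Hin orbT.
Qed.

End Soundness.

(** * From entailment back to derivations *)

Section GrammarSoundness.
Variable G : unary_cgrammar.

Definition nt_lang (X : nonterminal G) : language :=
  fun n => lang X (nseq n tt).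

(** [P] is general because [word_lang] accumulates from the left: [p] is the length already
    consumed. Over one letter, a length determines the word of each factor. *)
Lemma word_factorization (P : language) (al : seq ('I_(num_nt G) + unit)) n :
  word_lang nt_lang P al n ->
  exists2 us : seq (seq unit), size us = size al
    & (exists2 p, P p & n = p + size (flatten us)) /\
      (forall q, q \in zip al us -> derives q.1 q.2).
Proof.
elim: al P => [|x al IH] P /=.
  by exists [::] => //; split => //; exists n; rewrite ?addn0.
move=> /IH[us Hs [[p [p1 [q [Hp1 Hq ->]]] ->] H]].
exists (nseq q tt :: us); first by rewrite /= Hs.
split; first by exists p1 => //=; rewrite size_cat size_nseq addnA.
move=> r; rewrite inE => /orP[/eqP->/=|]; last exact: H.
by case: x Hq => [X //|[] <-]; exact: derives_axiom.
Qed.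

Lemma unary_wordP (w : seq unit) : w = nseq (size w) tt.
Proof. by elim: w => //= -[] w <-. Qed.

Lemma rule_sound (X : nonterminal G) als n :
  (X, als) \in rules G -> body_lang nt_lang als n -> nt_lang X n.
Proof.
move=> HX Hb.
have [uss [Hs [Hw Hz]]] : exists uss : seq (seq (seq unit)),
    shape uss = shape als /\
    ((forall us, us \in uss -> flatten us = nseq n tt) /\
    (forall p, p \in zip (flatten als) (flatten uss) -> derives p.1 p.2)).
  elim: als {HX} Hb => [|al als IH] Hb; first by exists [::].
  have [|uss [Hs [Hw Hz]]] := IH.
    by move=> al' Hal; apply: Hb; rewrite inE Hal orbT.
  have [|us Hsz [[p <- E] H]] := @word_factorization (eq 0) al n.
    by apply: Hb; rewrite inE eqxx.
  exists (us :: uss); split; first by rewrite /= Hs Hsz.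
  split=> [us'|q].
    by rewrite inE => /orP[/eqP->|/Hw//]; rewrite [LHS]unary_wordP E.
  by rewrite /= zip_cat // mem_cat => /orP[/H|/Hz].
exact: derives_rule HX Hs Hw Hz.
Qed.

(** The position in the list is the name: first [name_A], [name_C] and [name_U], then the
    nonterminals, then the fresh names of the rules. *)
Definition grammar_langs : seq language :=
  [:: eq 0; eq 1; (fun=> True)] ++ [seq nt_lang X | X <- enum 'I_(num_nt G)] ++
  rules_langs nt_lang (rules G).

Lemma grammar_sound (X : nonterminal G) n :
  entails (grammar_tbox G) (SubNext name_A (Posz n) X.+3) -> lang X (nseq n tt).
Proof.
pose L : cname -> language := nth (eq 0) grammar_langs.
have LD (Y : nonterminal G) : L Y.+3 = nt_lang Y.
  rewrite /L /grammar_langs /= nth_cat size_map size_enum_ord ltn_ord.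
  by rewrite (nth_map Y) ?size_enum_ord // nth_ord_enum.
have LR : agrees (eq 0) L (num_nt G).+3 (rules_langs nt_lang (rules G)).
  move=> j Hj; rewrite !addSn /L /grammar_langs /= nth_cat.
  by rewrite size_map size_enum_ord ltnNge leq_addr addKn.
move=> /(@entails_closed L (fun r => L r.2)); rewrite LD; apply => //.
move=> ci /In_cat[/= [<-|[<-|[<-|//]]]|/In_cat[|]] //.
- by move=> m <-.
- rewrite /nt_incls; elim: (iota _ _) => //= B s IH [<-|/IH//] m /=.
  by rewrite addn0.
- by apply: (rules_closed _ _ LD LR) => // Y als m; exact: rule_sound.
Qed.

Lemma grammar_tboxP (X : nonterminal G) n :
  entails (grammar_tbox G) (SubNext name_A (Posz n) X.+3) <->
  lang X (nseq n tt).
Proof.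
split; first exact: grammar_sound.
move=> HX I HI i d HA; have := grammar_complete HI HX HA.
by rewrite size_nseq.
Qed.

End GrammarSoundness.

(** * Counter programs and their compilation *)

Section CounterMachine.
Variable K : nat.

Inductive cmd :=
  | Skip
  | Emit of bool
  | Inc of 'I_K
  | Seq of cmd & cmd
  | WhileDec of 'I_K & cmd      (* while c > 0 do { c := c - 1; p } *)
  | WhileRead of cmd            (* while the next input bit is 1 do p *)
  | IfRead of cmd & cmd.

(* Remaining input, counters, output produced so far. *)
Definition store : Type := (seq bool * seq nat * seq bool)%type.

Definition get (s : seq nat) (c : nat) : nat := nth 0 s c.

(* The last argument is the number of machine steps of the compiled command. *)
Inductive exec : cmd -> store -> store -> nat -> Prop :=
  | ExecSkip s : exec Skip s s 0
  | ExecEmit b i r o : exec (Emit b) (i, r, o) (i, r, rcons o b) 1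
  | ExecInc (c : 'I_K) i r o :
      exec (Inc c) (i, r, o) (i, set_nth 0 r c (get r c).+1, o) 1
  | ExecSeq p q s1 s2 s3 t1 t2 :
      exec p s1 s2 t1 -> exec q s2 s3 t2 -> exec (Seq p q) s1 s3 (t1 + t2)
  | ExecDec0 (c : 'I_K) p i r o :
      get r c = 0 -> exec (WhileDec c p) (i, r, o) (i, r, o) 1
  | ExecDecS (c : 'I_K) p i r o n s2 s3 t1 t2 :
      get r c = n.+1 ->
      exec p (i, set_nth 0 r c n, o) s2 t1 -> exec (WhileDec c p) s2 s3 t2 ->
      exec (WhileDec c p) (i, r, o) s3 (1 + (t1 + (1 + t2)))
  | ExecReadF p i r o :
      exec (WhileRead p) (false :: i, r, o) (i, r, o) 1
  | ExecReadT p i r o s2 s3 t1 t2 :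
      exec p (i, r, o) s2 t1 -> exec (WhileRead p) s2 s3 t2 ->
      exec (WhileRead p) (true :: i, r, o) s3 (1 + (t1 + (1 + t2)))
  | ExecIfT p q i r o s t :
      exec p (i, r, o) s t ->
      exec (IfRead p q) (true :: i, r, o) s (1 + (t + 1))
  | ExecIfF p q i r o s t :
      exec q (i, r, o) s t ->
      exec (IfRead p q) (false :: i, r, o) s (1 + t).

Inductive instr :=
  | IHalt
  | IInit
  | IEmit of bool
  | IInc of 'I_K
  | IDec of 'I_K & nat          (* jump if the counter is 0 *)
  | IRead of nat                (* jump if the bit read is 0 *)
  | IJmp of nat.

(** Jumps are absolute, with [a] the address of the first instruction. Exits and else branches lie
    one past the [IJmp] that closes the preceding block. *)
Fixpoint compile (p : cmd) (a : nat) : seq instr :=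
  match p with
  | Skip => [::]
  | Emit b => [:: IEmit b]
  | Inc c => [:: IInc c]
  | Seq p q => let cp := compile p a in cp ++ compile q (a + size cp)
  | WhileDec c p =>
      let cp := compile p a.+1 in
      IDec c (a.+1 + size cp).+1 :: cp ++ [:: IJmp a]
  | WhileRead p =>
      let cp := compile p a.+1 in
      IRead (a.+1 + size cp).+1 :: cp ++ [:: IJmp a]
  | IfRead p q =>
      let cp := compile p a.+1 in
      let cq := compile q (a.+1 + size cp).+1 in
      IRead (a.+1 + size cp).+1 ::
        cp ++ IJmp ((a.+1 + size cp).+1 + size cq) :: cq
  end.

(** * Simulation of the instructions by a Turing machine *)

Variable code : seq instr.

Let tape : Type := 'I_K.+2.
Let symb : Type := cell void.

Definition counter_tape (c : 'I_K) : tape := inord c.+1.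

Definition mark : symb := Some (inl true).

Definition act_on (r : tape -> symb) (k : tape) (a : symb * move) (j : tape) :
    symb * move :=
  if j == k then a else (r j, MoveN).

Definition act (q : nat) (x : instr) (r : tape -> symb) :
    option ('I_(size code).+1 * (tape -> symb * move)) :=
  match x with
  | IHalt => None
  | IInit => Some (inord q.+1, fun j =>
      if (j == ord0) || (j == ord_max) then (r j, MoveN) else (mark, MoveN))
  | IEmit b => Some (inord q.+1, act_on r ord_max (Some (inl b), MoveR))
  | IInc c =>
      let k := counter_tape c in Some (inord q.+1, act_on r k (r k, MoveR))
  | IDec c a =>
      let k := counter_tape c in
      if r k == mark then Some (inord a, act_on r k (r k, MoveN))
      else Some (inord q.+1, act_on r k (r k, MoveL))
  | IRead a =>
      Some (inord (if r ord0 == mark then q.+1 else a),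
            act_on r ord0 (r ord0, MoveR))
  | IJmp a => Some (inord a, act_on r ord0 (r ord0, MoveN))
  end.

(** The default [IHalt] makes the additional state [size code] the halting one. *)
Definition delta (q : 'I_(size code).+1) (r : {ffun tape -> symb}) :
    option ('I_(size code).+1 * (tape -> symb * move)) :=
  act q (nth IHalt code q) r.

Definition counter_machine : machine :=
  @Machine K 'I_(size code).+1 void ord0 delta.

(* A counter is the position of the head on a tape marked at 0 only, so that
   testing for 0 is reading the cell under the head. *)
Definition counter_cells (x : int) : symb := if x == 0%R then mark else None.

(** The input head is located by the unread part [i]; the truncated subtraction is exact while [i]
    is a suffix of [w], an invariant of [compile_runs]. *)
Definition conf (w : seq bool) (q : nat) (s : store) : config counter_machine :=
  let: (i, r, o) := s in
  @Config counter_machine (inord q)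
    (fun j => Posz (if j == ord0 then size w - size i
                    else if j == ord_max then size o else get r j.-1))
    (fun j => if j == ord0 then tape_of void w
              else if j == ord_max then tape_of void o else counter_cells).

Definition code_at (a : nat) (l : seq instr) : Prop :=
  exists l1 l2, code = l1 ++ l ++ l2 /\ size l1 = a.

Lemma code_at_cat a l1 l2 :
  code_at a (l1 ++ l2) -> code_at a l1 /\ code_at (a + size l1) l2.
Proof.
case=> [m1 [m2 [E <-]]]; split.
  by exists m1, (l2 ++ m2); rewrite E -catA.
by exists (m1 ++ l1), m2; rewrite E -!catA size_cat.
Qed.

Lemma code_at_cons a x l :
  code_at a (x :: l) ->
  [/\ nth IHalt code a = x, a < size code & code_at a.+1 l].
Proof.
case=> [m1 [m2 [E <-]]]; split.
- by rewrite E nth_cat ltnn subnn.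
- by rewrite E size_cat /= addnS ltnS leq_addr.
- by exists (rcons m1 x), m2; rewrite E size_rcons cat_rcons.
Qed.

Local Notation runs t c c' :=
  (iter t (obind (@step counter_machine)) (Some c) = Some c').

Lemma runs_trans t1 t2 c1 c2 c3 :
  runs t1 c1 c2 -> runs t2 c2 c3 -> runs (t1 + t2) c1 c3.
Proof. by rewrite addnC iterD => ->. Qed.

Lemma runs_step t c1 c2 c3 :
  step c1 = Some c2 -> runs t c2 c3 -> runs (1 + t) c1 c3.
Proof. by move=> H; apply: runs_trans. Qed.

Definition scan (w : seq bool) (s : store) : {ffun tape -> symb} :=
  [ffun j => cf_tape (conf w 0 s) j (cf_head (conf w 0 s) j)].

(** Heads and tapes of [conf] do not depend on the state, so 0 stands in for it. For an instruction
    acting on one tape, a step reduces to pointwise conditions on heads and cells. *)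
Lemma step_act w q q' k a s s' :
  delta (inord q) (scan w s) = Some (inord q', act_on (scan w s) k a) ->
  (forall j, cf_head (conf w 0 s') j
     = (cf_head (conf w 0 s) j + (if j == k then shift a.2 else 0))%R) ->
  (forall j x, cf_tape (conf w 0 s') j x =
     if (j == k) && (x == cf_head (conf w 0 s) k) then a.1
     else cf_tape (conf w 0 s) j x) ->
  step (conf w q s) = Some (conf w q' s').
Proof.
rewrite /step => Hd Hh Ht.
case: s Hd Hh Ht => [[i r] o]; case: s' => [[i' r'] o'] Hd Hh Ht.
rewrite [tm_delta _ _]Hd /=; congr (Some (Config _ _ _)).
  apply: functional_extensionality => j.
  by rewrite [RHS]Hh /= /act_on; case: (j == k).
apply: functional_extensionality => j; apply: functional_extensionality => x.
rewrite [RHS]Ht /act_on; case: (eqVneq j k) => [->|_] //=.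
by case: (eqVneq x) => [->|//]; rewrite ffunE.
Qed.

Lemma delta_code w q s :
  q < size code ->
  delta (inord q) (scan w s) = act q (nth IHalt code q) (scan w s).
Proof. by move=> Hq; rewrite /delta inordK // ltnW. Qed.

Lemma val_counter_tape c : counter_tape c = c.+1 :> nat.
Proof. by rewrite inordK // !ltnS ltnW. Qed.

Lemma counter_tape_neq0 c : (counter_tape c == ord0) = false.
Proof. by rewrite -val_eqE /= val_counter_tape. Qed.

Lemma counter_tape_neq_max c : (counter_tape c == ord_max) = false.
Proof.
rewrite -val_eqE /= val_counter_tape eqSS.
by apply/negbTE; rewrite neq_ltn ltn_ord.
Qed.

Lemma counter_tape_eq (j : tape) (c : 'I_K) :
  j != ord0 -> (j.-1 == c :> nat) = (j == counter_tape c).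
Proof. by rewrite -!val_eqE /= val_counter_tape; case: (nat_of_ord j). Qed.

Lemma scan_counter w i r o (c : 'I_K) :
  scan w (i, r, o) (counter_tape c) = counter_cells (get r c).
Proof.
by rewrite ffunE /= counter_tape_neq0 counter_tape_neq_max val_counter_tape.
Qed.

Lemma get_set r (c : 'I_K) v n :
  get (set_nth 0 r c v) n = if n == c then v else get r n.
Proof. by rewrite /get nth_set_nth. Qed.

(* Writing back the scanned symbol leaves the tape unchanged. *)
Lemma cf_tape_scan w s k j x :
  cf_tape (conf w 0 s) j x =
  if (j == k) && (x == cf_head (conf w 0 s) k) then scan w s k
  else cf_tape (conf w 0 s) j x.
Proof.
by case: eqVneq => [->|//]; case: eqVneq => [->|//]; rewrite ffunE.
Qed.

Lemma step_emit w q i r o b :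
  q < size code -> nth IHalt code q = IEmit b ->
  step (conf w q (i, r, o)) = Some (conf w q.+1 (i, r, rcons o b)).
Proof.
move=> Hq E; apply: step_act; first by rewrite delta_code // E.
  move=> j /=; case: (eqVneq j ord_max) => [->|_]; last by rewrite addr0.
  by rewrite size_rcons -PoszD addn1.
move=> j x /=; case: (eqVneq j ord_max) => [->|//] /=.
case: x => [n|n] //=.
rewrite eqxx map_rcons nth_rcons size_map eqz_nat.
by case: ltngtP => // Hn; rewrite nth_default // size_map ltnW.
Qed.

Lemma step_counter w q q' i r o (c : 'I_K) m v :
  q < size code ->
  delta (inord q) (scan w (i, r, o)) =
    Some (inord q', act_on (scan w (i, r, o)) (counter_tape c)
                      (scan w (i, r, o) (counter_tape c), m)) ->
  Posz v = (Posz (get r c) + shift m)%R ->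
  step (conf w q (i, r, o)) = Some (conf w q' (i, set_nth 0 r c v, o)).
Proof.
move=> Hq E Hv; apply: (step_act E).
  move=> j /=; case: (eqVneq j ord0) => [->|Hj].
    by rewrite eq_sym counter_tape_neq0 addr0.
  case: (eqVneq j ord_max) => [->|_].
    by rewrite eq_sym counter_tape_neq_max addr0.
  rewrite get_set counter_tape_eq //; case: (eqVneq j) => [->|_].
    by rewrite val_counter_tape Hv.
  by rewrite addr0.
by move=> j x; exact: (cf_tape_scan w (i, r, o)).
Qed.

Lemma step_inc w q i r o (c : 'I_K) :
  q < size code -> nth IHalt code q = IInc c ->
  step (conf w q (i, r, o)) =
    Some (conf w q.+1 (i, set_nth 0 r c (get r c).+1, o)).
Proof.
move=> Hq E; apply: (@step_counter _ _ _ _ _ _ _ MoveR) => //.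
  by rewrite delta_code // E.
by rewrite -PoszD addn1.
Qed.

Lemma step_decS w q i r o (c : 'I_K) a n :
  q < size code -> nth IHalt code q = IDec c a -> get r c = n.+1 ->
  step (conf w q (i, r, o)) = Some (conf w q.+1 (i, set_nth 0 r c n, o)).
Proof.
move=> Hq E Hn; apply: (@step_counter _ _ _ _ _ _ _ MoveL) => //.
  by rewrite delta_code // E /= scan_counter Hn.
by rewrite Hn -addn1 PoszD addrK.
Qed.

Lemma step_still w q q' s k :
  delta (inord q) (scan w s) =
    Some (inord q', act_on (scan w s) k (scan w s k, MoveN)) ->
  step (conf w q s) = Some (conf w q' s).
Proof.
move=> E; apply: (step_act E) => [j|j x]; last exact: cf_tape_scan.
by rewrite /= if_same addr0.
Qed.

Lemma step_dec0 w q i r o (c : 'I_K) a :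
  q < size code -> nth IHalt code q = IDec c a -> get r c = 0 ->
  step (conf w q (i, r, o)) = Some (conf w a (i, r, o)).
Proof.
move=> Hq E Hn; apply: (@step_still _ _ _ _ (counter_tape c)).
by rewrite delta_code // E /= scan_counter Hn.
Qed.

Lemma step_jmp w q s a :
  q < size code -> nth IHalt code q = IJmp a ->
  step (conf w q s) = Some (conf w a s).
Proof. by move=> Hq E; apply: step_still; rewrite delta_code // E. Qed.

Lemma suffix_nth (b : bool) i w :
  suffix (b :: i) w -> nth None [seq Some (@inl bool void x) | x <- w]
     (size w - (size i).+1) = Some (inl b).
Proof.
case/suffixP => v ->; rewrite size_cat addnK map_cat nth_cat size_map ltnn.
by rewrite subnn.
Qed.

Lemma step_read w q i r o b a :
  q < size code -> nth IHalt code q = IRead a -> suffix (b :: i) w ->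
  step (conf w q (b :: i, r, o)) =
    Some (conf w (if b then q.+1 else a) (i, r, o)).
Proof.
move=> Hq E Hi;
apply: (@step_act _ _ _ ord0 (scan w (b :: i, r, o) ord0, MoveR)).
- rewrite delta_code // E; congr (Some (inord _, _)).
  by rewrite ffunE /= (suffix_nth Hi); case: b {Hi}.
- move=> j /=; case: (eqVneq j ord0) => [_|_]; last by rewrite addr0.
  have := size_suffix Hi; rewrite /= => Hs.
  by rewrite -PoszD addn1 subnSK.
- by move=> j x; exact: (cf_tape_scan w (b :: i, r, o)).
Qed.

Lemma suffix_behead (b : bool) i w : suffix (b :: i) w -> suffix i w.
Proof. by apply: suffix_trans; exact: (suffix_suffix [:: b]). Qed.

Lemma eq_conf w q q' s : q = q' -> Some (conf w q s) = Some (conf w q' s).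
Proof. by move->. Qed.

(** The induction is on the execution, not on the program: after one round of a loop, the remaining
    rounds run from the same address [a]. *)
Lemma compile_runs p s s' t :
  exec p s s' t -> forall w a, code_at a (compile p a) -> suffix s.1.1 w ->
  suffix s'.1.1 w /\
  runs t (conf w a s) (conf w (a + size (compile p a)) s').
Proof.
elim=> {p s s' t}.
- by move=> s w a _ Hs /=; rewrite addn0.
- move=> b i r o w a /code_at_cons[E Hq _] Hi; split=> //=.
  by rewrite addn1; apply: step_emit.
- move=> c i r o w a /code_at_cons[E Hq _] Hi; split=> //=.
  by rewrite addn1; apply: step_inc.
- move=> p q s1 s2 s3 t1 t2 _ IH1 _ IH2 w a /= /code_at_cat[H1 H2] Hs.
  have [Hs2 R1] := IH1 _ _ H1 Hs; have [Hs3 R2] := IH2 _ _ H2 Hs2.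
  by split=> //; rewrite size_cat addnA; apply: runs_trans R1 R2.
- move=> c p i r o Hc w a /= /code_at_cons[E Hq _] Hi; split=> //.
  rewrite [LHS](step_dec0 _ _ _ Hq E Hc); apply: eq_conf.
  rewrite size_cat /=; lia.
- move=> c p i r o n s2 s3 t1 t2 Hc _ IH1 _ IH2 w a /= Ha Hi.
  have [E Hq] := code_at_cons Ha; case/code_at_cat=> H1 /code_at_cons[E' Hq' _].
  have [Hs2 R1] := IH1 _ _ H1 Hi; have [Hs3 R2] := IH2 _ _ Ha Hs2.
  split=> //; apply: runs_step (step_decS _ _ _ Hq E Hc) _.
  by apply: runs_trans R1 _; apply: runs_step (step_jmp _ _ Hq' E') R2.
- move=> p i r o w a /= /code_at_cons[E Hq _] Hi.
  split; first exact: suffix_behead Hi.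
  rewrite [LHS](step_read _ _ Hq E Hi); apply: eq_conf.
  rewrite size_cat /=; lia.
- move=> p i r o s2 s3 t1 t2 _ IH1 _ IH2 w a /= Ha Hi.
  have [E Hq] := code_at_cons Ha; case/code_at_cat=> H1 /code_at_cons[E' Hq' _].
  have [Hs2 R1] := IH1 _ _ H1 (suffix_behead Hi).
  have [Hs3 R2] := IH2 _ _ Ha Hs2.
  split=> //; apply: runs_step (step_read _ _ Hq E Hi) _.
  by apply: runs_trans R1 _; apply: runs_step (step_jmp _ _ Hq' E') R2.
- move=> p q i r o s t _ IH w a /= Ha Hi.
  have [E Hq] := code_at_cons Ha; case/code_at_cat=> H1 /code_at_cons[E' Hq' _].
  have [Hs R1] := IH _ _ H1 (suffix_behead Hi).
  split=> //; apply: runs_step (step_read _ _ Hq E Hi) _.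
  apply: runs_trans R1 _; rewrite [LHS](step_jmp _ _ Hq' E').
  apply: eq_conf; rewrite size_cat /=; lia.
- move=> p q i r o s t _ IH w a /= Ha Hi.
  have [E Hq] := code_at_cons Ha; case/code_at_cat=> H1 /code_at_cons[_ _ H2].
  have [Hs R1] := IH _ _ H2 (suffix_behead Hi).
  split=> //; apply: runs_step (step_read _ _ Hq E Hi) _.
  rewrite R1; apply: eq_conf; rewrite size_cat /=; lia.
Qed.

End CounterMachine.

(** [IInit] at address 0 marks the counter tapes, whence the start address 1 and the one additional
    step. *)
Lemma exec_computes K (p : cmd K) w i r v t :
  exec p (w, nseq K 0, [::]) (i, r, v) t ->
  computes_in (counter_machine (IInit K :: compile p 1)) w t.+1 v.
Proof.
set code := _ :: _ => Hp.
have Hc : code_at code 1 (compile p 1)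
  by exists [:: IInit K], [::]; rewrite cats0.
have [_ R] := compile_runs Hp Hc (suffix_refl w).
exists (conf code w (size code) (i, r, v)); split.
- rewrite -add1n; apply: runs_step R.
  rewrite /step /= /delta /=; congr (Some (Config _ _ _)).
    apply: functional_extensionality => j.
    by rewrite subnn /get nth_nseq !if_same; case: ifP.
  apply: functional_extensionality => j; apply: functional_extensionality => x.
  rewrite /counter_cells ffunE; case: (eqVneq j ord0) => [->|_] /=.
    by case: eqVneq => [->|].
  case: (eqVneq j ord_max) => [_|_] /=.
    by rewrite if_same; case: x => [n|//] /=; rewrite nth_nil.
  by case: eqVneq.
- by rewrite /step /= /delta inordK // nth_default.
- by move=> x; rewrite /= eqxx.
Qed.

(** * The transducer *)

Section Transducer.

Local Notation "p ;; q" := (Seq p q) (at level 60, right associativity).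

(* The next fresh name, the name for the conjuncts still to be read, and a
   scratch counter that is 0 between two commands. *)
Definition c_fresh : 'I_3 := @Ordinal 3 0 isT.
Definition c_rest : 'I_3 := @Ordinal 3 1 isT.
Definition c_tmp : 'I_3 := @Ordinal 3 2 isT.

Definition emit_bits (l : seq bool) : cmd 3 :=
  foldr (fun b p => Emit 3 b ;; p) (Skip 3) l.

(** Reading a counter empties it, so its value is saved in [c_tmp] and moved back. *)
Definition emit_ones (c : 'I_3) : cmd 3 :=
  WhileDec c (Inc c_tmp ;; Emit 3 true) ;; WhileDec c_tmp (Inc c).

Definition copy_ones : cmd 3 := WhileRead (Emit 3 true).

Definition rest_gets_fresh : cmd 3 :=
  WhileDec c_rest (Skip 3) ;;
  WhileDec c_fresh (Inc c_tmp ;; Inc c_rest) ;; WhileDec c_tmp (Inc c_fresh).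

Local Notation F := false.
Local Notation T := true.

(** Here and below, an inclusion opens with the list bit [T] and two tag bits. A number is a block
    of ones closed by [F], and the shift 0 is [F; F]: its sign and an empty block. *)
Definition nt_cmd : cmd 3 :=
  emit_bits [:: T; F; F] ;; emit_ones c_fresh ;; emit_bits [:: F; F; F] ;;
  emit_ones c_fresh ;; emit_bits [:: F] ;; Inc c_fresh.

(** The branch prints the name of the symbol read: three ones before the copied block give [X.+3],
    and a single one gives [name_C]. *)
Definition symbol_cmd : cmd 3 :=
  emit_bits [:: T; T; T] ;; emit_ones c_fresh ;; emit_bits [:: F; T] ;;
  emit_ones c_fresh ;; emit_bits [:: F; F] ;;
  emit_bits [:: T; T; F; T] ;; emit_ones c_fresh ;; emit_bits [:: F] ;;
  IfRead (emit_bits [:: T; T; T] ;; copy_ones) (emit_bits [:: T]) ;;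
  emit_bits [:: F] ;; emit_ones c_fresh ;; emit_bits [:: T; F] ;; Inc c_fresh.

Definition conjunct_cmd : cmd 3 :=
  emit_bits [:: T; F; F; F; F; F] ;; emit_ones c_fresh ;; emit_bits [:: F] ;;
  WhileRead symbol_cmd ;;
  emit_bits [:: T; F; T] ;; emit_ones c_fresh ;; emit_bits [:: F] ;;
  emit_ones c_fresh ;; emit_bits [:: T; F] ;; emit_ones c_rest ;;
  emit_bits [:: F] ;; Inc c_fresh ;; rest_gets_fresh ;; Inc c_fresh.

(** [c_rest] first names the intersection of all conjuncts. After the loop it names the empty one,
    which the last inclusion places above [name_U]. *)
Definition rule_cmd : cmd 3 :=
  emit_bits [:: T; F; F] ;; emit_ones c_fresh ;;
  emit_bits [:: F; F; F; T; T; T] ;; copy_ones ;; emit_bits [:: F] ;;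
  rest_gets_fresh ;; Inc c_fresh ;;
  WhileRead conjunct_cmd ;;
  emit_bits [:: T; F; F; T; T; F; F; F] ;; emit_ones c_rest ;; emit_bits [:: F].

Definition enc_incls (cis : tbox) : seq bool :=
  flatten [seq true :: enc_inclusion ci | ci <- cis].

Definition transducer : cmd 3 :=
  Inc c_fresh ;; Inc c_fresh ;; Inc c_fresh ;;
  emit_bits (enc_incls base_incls) ;;
  WhileRead nt_cmd ;; WhileRead rule_cmd ;; emit_bits [:: F; F].

Definition exec_le K (p : cmd K) (s s' : store) (b : nat) : Prop :=
  exists2 t, t <= b & exec p s s' t.

Lemma exec_le_seq K (p q : cmd K) s1 s2 s3 b1 b2 :
  exec_le p s1 s2 b1 -> exec_le q s2 s3 b2 -> exec_le (p ;; q) s1 s3 (b1 + b2).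
Proof.
move=> [t1 H1 E1] [t2 H2 E2]; exists (t1 + t2); first exact: leq_add.
exact: ExecSeq E1 E2.
Qed.

Lemma exec_le_eq K (p : cmd K) s s1 s2 b1 b2 :
  exec_le p s s1 b1 -> s1 = s2 -> b1 <= b2 -> exec_le p s s2 b2.
Proof. by move=> [t H E] <- Hb; exists t => //; apply: leq_trans Hb. Qed.

Lemma exec_le_emit K b i r o :
  exec_le (Emit K b) (i, r, o) (i, r, rcons o b) 1.
Proof. by exists 1 => //; exact: ExecEmit. Qed.

Lemma exec_le_inc K (c : 'I_K) i r o :
  exec_le (Inc c) (i, r, o) (i, set_nth 0 r c (get r c).+1, o) 1.
Proof. by exists 1 => //; exact: ExecInc. Qed.

Lemma exec_le_readT K (p : cmd K) i r o s2 s3 b1 b2 :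
  exec_le p (i, r, o) s2 b1 -> exec_le (WhileRead p) s2 s3 b2 ->
  exec_le (WhileRead p) (true :: i, r, o) s3 (b1.+2 + b2).
Proof.
move=> [t1 H1 E1] [t2 H2 E2]; exists (1 + (t1 + (1 + t2))); first by lia.
exact: ExecReadT E1 E2.
Qed.

Lemma exec_le_readF K (p : cmd K) i r o :
  exec_le (WhileRead p) (false :: i, r, o) (i, r, o) 1.
Proof. by exists 1 => //; exact: ExecReadF. Qed.

Lemma exec_le_ifT K (p q : cmd K) i r o s b :
  exec_le p (i, r, o) s b -> exec_le (IfRead p q) (true :: i, r, o) s b.+2.
Proof.
move=> [t H E]; exists (1 + (t + 1)); first by lia.
exact: ExecIfT.
Qed.

Lemma exec_le_ifF K (p q : cmd K) i r o s b :
  exec_le q (i, r, o) s b -> exec_le (IfRead p q) (false :: i, r, o) s b.+1.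
Proof. by move=> [t H E]; exists (1 + t) => //; exact: ExecIfF. Qed.

Lemma exec_le_bits l i r o :
  exec_le (emit_bits l) (i, r, o) (i, r, o ++ l) (size l).
Proof.
exists (size l) => //; elim: l o => [|b l IH] o /=.
  by rewrite cats0; exact: ExecSkip.
rewrite -cat_rcons -[(size l).+1]add1n.
  by apply: ExecSeq; [exact: ExecEmit|exact: IH].
Qed.

(* [r] gives the counters in terms of the values of [c] and [c_tmp]. *)
Lemma exec_restore (c : 'I_3) (r : nat -> nat -> seq nat) i n m o :
  (forall n m, get (r n m) c_tmp = m) ->
  (forall n m k, set_nth 0 (r n m) c_tmp k = r n k) ->
  (forall n m, get (r n m) c = n) ->
  (forall n m k, set_nth 0 (r n m) c k = r k m) ->
  exec (WhileDec c_tmp (Inc c)) (i, r n m, o) (i, r (n + m) 0, o) (3 * m + 1).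
Proof.
move=> Gt St Gc Sc; elim: m n => [|m IH] n.
  by rewrite addn0; apply: ExecDec0; rewrite Gt.
have -> : 3 * m.+1 + 1 = 1 + (1 + (1 + (3 * m + 1))) by lia.
apply: ExecDecS; [exact: Gt|exact: ExecInc|].
by rewrite St Gc Sc addnS -addSn; exact: IH.
Qed.

(** Per unit, four steps to test, save, emit and jump, and three to restore; the final tests of the
    two loops add 2. *)
Lemma exec_le_ones (c : 'I_3) (r : nat -> nat -> seq nat) i n o :
  (forall n m, get (r n m) c_tmp = m) ->
  (forall n m k, set_nth 0 (r n m) c_tmp k = r n k) ->
  (forall n m, get (r n m) c = n) ->
  (forall n m k, set_nth 0 (r n m) c k = r k m) ->
  exec_le (emit_ones c) (i, r n 0, o) (i, r n 0, o ++ nseq n true) (7 * n + 2).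
Proof.
move=> Gt St Gc Sc; exists ((4 * n + 1) + (3 * n + 1)); first by lia.
apply: (@ExecSeq _ _ _ _ (i, r 0 n, o ++ nseq n true)); last first.
  exact: (exec_restore i 0 n _ Gt St Gc Sc).
suff H m : exec (WhileDec c (Inc c_tmp ;; Emit 3 true)) (i, r n m, o)
    (i, r 0 (m + n), o ++ nseq n true) (4 * n + 1) by exact: H.
elim: n m o => [|n IH] m o.
  by rewrite addn0 cats0; apply: ExecDec0; rewrite Gc.
have -> : 4 * n.+1 + 1 = 1 + ((1 + 1) + (1 + (4 * n + 1))) by lia.
apply: ExecDecS; [exact: Gc|apply: ExecSeq; [exact: ExecInc|exact: ExecEmit]|].
by rewrite Sc Gt St addnS -addSn /= -cat_rcons; exact: IH.
Qed.

Lemma exec_le_fresh i f d o :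
  exec_le (emit_ones c_fresh) (i, [:: f; d; 0], o)
    (i, [:: f; d; 0], o ++ nseq f true) (7 * f + 2).
Proof. exact: (@exec_le_ones _ (fun n m => [:: n; d; m])). Qed.

Lemma exec_le_rest i f d o :
  exec_le (emit_ones c_rest) (i, [:: f; d; 0], o)
    (i, [:: f; d; 0], o ++ nseq d true) (7 * d + 2).
Proof. exact: (@exec_le_ones _ (fun n m => [:: f; n; m])). Qed.

Lemma exec_le_rest_gets_fresh i f d o :
  exec_le rest_gets_fresh (i, [:: f; d; 0], o) (i, [:: f; f; 0], o)
    (7 * f + 2 * d + 3).
Proof.
exists ((2 * d + 1) + ((4 * f + 1) + (3 * f + 1))); first by lia.
apply: (@ExecSeq _ _ _ _ (i, [:: f; 0; 0], o)).
  elim: d => [|d IH]; first exact: ExecDec0.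
  have -> : 2 * d.+1 + 1 = 1 + (0 + (1 + (2 * d + 1))) by lia.
  by apply: ExecDecS; [reflexivity|exact: ExecSkip|].
apply: (@ExecSeq _ _ _ _ (i, [:: 0; f; f], o)).
  suff H n m : exec (WhileDec c_fresh (Inc c_tmp ;; Inc c_rest))
      (i, [:: n; m; m], o) (i, [:: 0; m + n; m + n], o) (4 * n + 1) by exact: H.
  elim: n m => [|n IH] m; first by rewrite addn0; exact: ExecDec0.
  have -> : 4 * n.+1 + 1 = 1 + ((1 + 1) + (1 + (4 * n + 1))) by lia.
  apply: ExecDecS; [reflexivity|apply: ExecSeq; exact: ExecInc|].
  by rewrite addnS -addSn; exact: IH.
exact: (@exec_restore c_fresh (fun n m => [:: n; f; m]) i 0 f o).
Qed.

Lemma exec_le_copy n i r o :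
  exec_le copy_ones (enc_nat n ++ i, r, o) (i, r, o ++ nseq n true) (3 * n + 1).
Proof.
elim: n o => [|n IH] o; first by rewrite cats0; exact: exec_le_readF.
apply: exec_le_eq.
- apply: exec_le_readT; last exact: (IH (rcons o true)).
  exact: exec_le_emit.
- by rewrite cat_rcons.
- by lia.
Qed.

Lemma enc_seq_cons X (enc : X -> seq bool) x s :
  enc_seq enc (x :: s) = true :: enc x ++ enc_seq enc s.
Proof. by rewrite /enc_seq /= rcons_cat. Qed.

Lemma size_enc_seq X (enc : X -> seq bool) s : size s < size (enc_seq enc s).
Proof.
elim: s => [|x s IH]; first by rewrite /enc_seq.
by rewrite enc_seq_cons /= size_cat; lia.
Qed.

Lemma enc_incls_cat cis1 cis2 :
  enc_incls (cis1 ++ cis2) = enc_incls cis1 ++ enc_incls cis2.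
Proof. by rewrite /enc_incls map_cat flatten_cat. Qed.

Lemma enc_incls_cons ci cis :
  enc_incls (ci :: cis) = true :: enc_inclusion ci ++ enc_incls cis.
Proof. by []. Qed.

Lemma size_enc_nat n : size (enc_nat n) = n.+1.
Proof. by rewrite size_rcons size_nseq. Qed.

Lemma enc_natE n : enc_nat n = nseq n true ++ [:: false].
Proof. by rewrite cats1. Qed.

(** A normal form for unary blocks: ones emitted after a block are pulled in front of it, where
    successors put them. *)
Lemma cat_nseqS X n (x : X) s : nseq n x ++ x :: s = x :: nseq n x ++ s.
Proof. by elim: n => //= n ->. Qed.

Ltac run := repeat first
  [ exact: exec_le_bits | exact: exec_le_fresh | exact: exec_le_rest
  | exact: exec_le_inc | exact: exec_le_rest_gets_fresh
  | apply: exec_le_seq ].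

Ltac flat :=
  rewrite /= ?enc_natE; do 4! rewrite -?catA ?cat_rcons ?cat_nseqS /=.

(** * Correctness and cost of the loops *)

Section Bound.
(** [M] bounds the names held in the counters, and [B] is the budget of one input bit. The fresh
    name plus the length of the list still to be read stays at most [M], as no more names are taken
    than bits are read. *)
Variable M : nat.
Let B := 100 * (M + 1).

Lemma nt_loop n f i o :
  f + n.+1 <= M ->
  exec_le (WhileRead nt_cmd) (enc_nat n ++ i, [:: f; 0; 0], o)
    (i, [:: f + n; 0; 0], o ++ enc_incls (nt_incls f n)) (B * n.+1).
Proof.
elim: n f o => [|n IH] f o Hf.
  rewrite cats0 addn0; apply: exec_le_eq; [exact: exec_le_readF|by []|].
  by rewrite /B; lia.
apply: exec_le_eq.
- by apply: exec_le_readT; [rewrite /nt_cmd; run|apply: (IH f.+1); lia].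
- congr (_, _, _); first by rewrite addSnnS.
  by rewrite /nt_incls /= enc_incls_cons; flat.
- by rewrite /= /B; nia.
Qed.


Section Words.
Variables (k d : nat).
Let sym := ('I_k + unit)%type.

Lemma symbol_exec (x : sym) f i o :
  exec_le symbol_cmd (enc_symbol x ++ i, [:: f; d; 0], o)
    (i, [:: f.+1; d; 0], o ++ enc_incls (word_incls f [:: x]))
    (28 * f + 40 + 3 * size (enc_symbol x)).
Proof.
case: x => [X|u]; apply: exec_le_eq.
- rewrite /symbol_cmd; do 8! (apply: exec_le_seq; first by run).
  apply: exec_le_seq; [apply: exec_le_ifT; apply: exec_le_seq;
    [by run|exact: (exec_le_copy X)]|by run].
- by congr (_, _, _); rewrite !enc_incls_cons; flat.
- by rewrite /= size_rcons size_nseq; lia.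
- rewrite /symbol_cmd; do 8! (apply: exec_le_seq; first by run).
  by apply: exec_le_seq; [apply: exec_le_ifF; run|run].
- by congr (_, _, _); rewrite !enc_incls_cons; flat.
- by rewrite /=; lia.
Qed.

Lemma word_loop (al : seq sym) f i o :
  f + size (enc_seq (@enc_symbol k) al) <= M ->
  exec_le (WhileRead symbol_cmd)
    (enc_seq (@enc_symbol k) al ++ i, [:: f; d; 0], o)
    (i, [:: f + size al; d; 0], o ++ enc_incls (word_incls f al))
    (B * size (enc_seq (@enc_symbol k) al)).
Proof.
elim: al f o => [|x al IH] f o Hf.
  rewrite cats0 addn0; apply: exec_le_eq; [exact: exec_le_readF|by []|].
  by rewrite /B /=; lia.
move: Hf; rewrite enc_seq_cons /= size_cat => Hf.
apply: exec_le_eq.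
- rewrite -catA; apply: exec_le_readT; first exact: symbol_exec.
  by apply: IH; lia.
- congr (_, _, _); first by rewrite addSnnS.
  by rewrite -catA -enc_incls_cat.
- have := leq_pmull (size (enc_symbol x)) (isT : 0 < 100).
  by rewrite /B; nia.
Qed.

End Words.

Section Rules.
Variable k : nat.
Local Notation sym := ('I_k + unit)%type.
Local Notation enc_word := (enc_seq (@enc_symbol k)).

(** The summand [98 * M + 98] is charged to the list bit in front of the conjunct; the 2 steps of
    the enclosing loop still fit into that bit's budget [B]. *)
Lemma conjunct_exec (al : seq sym) f d i o :
  f + size (enc_word al) < M -> d <= M ->
  exec_le conjunct_cmd (enc_word al ++ i, [:: f; d; 0], o)
    (i, [:: (f + size al).+2; (f + size al).+1; 0],
     o ++ enc_incls (SubNext name_A (Posz 0) f :: word_incls f al ++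
            [:: SubAnd (f + size al) (f + size al).+1 d]))
    (B * size (enc_word al) + (98 * M + 98)).
Proof.
move=> Hf Hd; have Hal := size_enc_seq (@enc_symbol k) al.
apply: exec_le_eq.
- rewrite /conjunct_cmd; do 3! (apply: exec_le_seq; first by run).
  apply: exec_le_seq; first by apply: word_loop; lia.
  by run.
- congr (_, _, _).
  by rewrite enc_incls_cons enc_incls_cat [in RHS]enc_incls_cons; flat.
- by rewrite /get /=; lia.
Qed.

(** The inclusion that closes a body is emitted only after the loop, by [rule_cmd]; [x] is the
    output before it, and [d'] the name it needs. *)
Lemma body_loop (als : seq (seq sym)) f d i o :
  f + size (enc_seq enc_word als) <= M -> d <= M ->
  exists d' x, [/\ d' <= M,
    enc_incls (body_incls f d als) =
      x ++ enc_incls [:: SubNext name_U (Posz 0) d']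
  & exec_le (WhileRead conjunct_cmd)
      (enc_seq enc_word als ++ i, [:: f; d; 0], o)
      (i, [:: f + body_width als; d'; 0], o ++ x)
      (B * size (enc_seq enc_word als))].
Proof.
elim: als f d o => [|al als IH] f d o Hf Hd.
  exists d, [::]; split=> //; rewrite cats0 addn0.
  apply: exec_le_eq; [exact: exec_le_readF|by []|].
  by rewrite /B /=; lia.
have Hal := size_enc_seq (@enc_symbol k) al.
move: Hf; rewrite enc_seq_cons /= size_cat => Hf.
pose c := SubNext name_A (Posz 0) f :: word_incls f al ++
            [:: SubAnd (f + size al) (f + size al).+1 d].
have [||d' [x [Hd' Hx E]]] :=
  IH (f + size al).+2 (f + size al).+1 (o ++ enc_incls c); [lia|lia|].
exists d', (enc_incls c ++ x); split=> //.
  by rewrite -catA -Hx -enc_incls_cat /c /= -catA.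
apply: exec_le_eq.
- rewrite -catA; apply: exec_le_readT; last exact: E.
  by apply: conjunct_exec; lia.
- rewrite catA; congr (_, [:: _; _; _], _).
  by rewrite /body_width /=; lia.
- by rewrite mulnS mulnDr /B; lia.
Qed.

Lemma rule_exec (rl : 'I_k * seq (seq sym)) f d i o :
  f + size (enc_seq enc_word rl.2) < M -> d <= M ->
  exists2 d', d' <= M & exec_le rule_cmd (enc_rule rl ++ i, [:: f; d; 0], o)
    (i, [:: (f + body_width rl.2).+1; d'; 0],
     o ++ enc_incls (SubNext f (Posz 0) rl.1.+3 :: body_incls f.+1 f rl.2))
    (B * size (enc_rule rl) + (98 * M + 98)).
Proof.
case: rl => X als /= Hf Hd.
pose o' := o ++ enc_incls [:: SubNext f (Posz 0) X.+3].
have [||d' [x [Hd' Hx E]]] := @body_loop als f.+1 f i o'; [lia|lia|].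
exists d' => //; apply: exec_le_eq.
- rewrite /enc_rule /= -catA /rule_cmd.
  do 3! (apply: exec_le_seq; first by run).
  apply: exec_le_seq; first exact: (exec_le_copy X).
  do 3! (apply: exec_le_seq; first by run).
  apply: exec_le_seq; first by rewrite [X in (_, _, X)](_ : _ = o');
    [exact: E|rewrite /o' enc_incls_cons; flat].
  by run.
- rewrite enc_incls_cons Hx /o' !enc_incls_cons; congr (_, _, _).
  by flat.
- rewrite /enc_rule size_cat mulnDr size_enc_nat /=.
  by rewrite /B; nia.
Qed.

Lemma rules_loop (rls : seq ('I_k * seq (seq sym))) f d i o :
  f + size (enc_seq (@enc_rule k) rls) <= M -> d <= M ->
  exists r, exec_le (WhileRead rule_cmd)
    (enc_seq (@enc_rule k) rls ++ i, [:: f; d; 0], o)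
    (i, r, o ++ enc_incls (rules_incls f rls))
    (B * size (enc_seq (@enc_rule k) rls)).
Proof.
elim: rls f d o => [|rl rls IH] f d o Hf Hd.
  exists [:: f; d; 0]; rewrite cats0.
  apply: exec_le_eq; [exact: exec_le_readF|by []|].
  by rewrite /B /=; lia.
have Hsz : size (enc_rule rl) = rl.1.+1 + size (enc_seq enc_word rl.2).
  by rewrite size_cat size_enc_nat.
move: Hf; rewrite enc_seq_cons /= size_cat => Hf.
have [|//|d' Hd' E] := @rule_exec rl f d (enc_seq (@enc_rule k) rls ++ i) o.
  by lia.
(* A body takes fewer names than its encoding has bits, which preserves the invariant for the next
   rule. *)
have Hw : body_width rl.2 < size (enc_seq enc_word rl.2).
  elim: (rl.2) => [|al als IHa]; first by rewrite /enc_seq.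
  have := size_enc_seq (@enc_symbol k) al.
  by rewrite enc_seq_cons /body_width /= size_cat -/(body_width _); lia.
pose cis := SubNext f (Posz 0) rl.1.+3 :: body_incls f.+1 f rl.2.
have [||r Er] := IH (f + body_width rl.2).+1 d' (o ++ enc_incls cis);
  [lia|lia|].
exists r; apply: exec_le_eq.
- by rewrite -catA; apply: exec_le_readT; [exact: E|exact: Er].
- by rewrite -catA -enc_incls_cat.
- by rewrite mulnS mulnDr /B; lia.
Qed.

End Rules.
End Bound.

Lemma enc_tbox_nameE cis A :
  enc_tbox_name (cis, A) = enc_incls cis ++ false :: enc_nat A.
Proof. by rewrite /enc_tbox_name /enc_seq cat_rcons. Qed.

(** With names counted from 3, [M] is [n + 3]. The loops cost at most [100 * (n + 4)] per bit, and
    one more such budget pays for the constant work before and after them. *)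
Lemma transducer_exec (G : unary_cgrammar) :
  exists i r, let n := size (enc_grammar G) in
  exec_le transducer (enc_grammar G, nseq 3 0, [::])
    (i, r, enc_tbox_name (grammar_tbox G, name_A)) (100 * (n + 4) * (n + 1)).
Proof.
rewrite enc_tbox_nameE /grammar_tbox !enc_incls_cat.
set n := size _.
have Hn : n = (num_nt G).+1 + size (enc_seq (@enc_rule (num_nt G)) (rules G)).
  by rewrite /n size_cat size_enc_nat.
have [||r E] := @rules_loop (n + 3) _ (rules G) (3 + num_nt G) 0 [::]
  (enc_incls base_incls ++ enc_incls (nt_incls 3 (num_nt G))); [lia|lia|].
exists [::], r; apply: exec_le_eq.
- rewrite /enc_grammar /transducer; do 4! (apply: exec_le_seq; first by run).
  apply: exec_le_seq; first by apply: (@nt_loop (n + 3) _ 3); lia.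
  by apply: exec_le_seq; [rewrite cats0 in E; exact: E|run].
- by rewrite -!catA.
- rewrite /=.
  by rewrite Hn; nia.
Qed.

End Transducer.

Theorem theorem6 :
  exists construct : unary_cgrammar -> tbox * cname,
    poly_time enc_grammar enc_tbox_name construct /\
    forall G : unary_cgrammar,
      let T := (construct G).1 in
      let A := (construct G).2 in
      [/\ future_tbox T, occurs A T
        & forall X : nonterminal G,
            exists2 B : cname, occurs B T
              & forall n : nat,
                  entails T (SubNext A (Posz n) B) <->
                  lang X (nseq n tt)].
Proof.
exists (fun G => (grammar_tbox G, name_A)); split; last first.
  move=> G; split=> [||X]; first exact: grammar_tbox_future.
    by rewrite /occurs.
  by exists X.+3 => [|n]; [exact: grammar_tbox_occurs_nt|exact: grammar_tboxP].
exists (counter_machine (IInit 3 :: compile transducer 1)).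
(* The last summand is the step that marks the counter tapes. *)
exists ((100%N)%:P * ('X + (4%N)%:P) * ('X + (1%N)%:P) + (1%N)%:P)%R => G.
have [i [r [t Ht E]]] := transducer_exec G.
exists t.+1; last exact: exec_computes E.
rewrite !(hornerM, hornerD, hornerC, hornerX).
by rewrite -[(_ + _)%R]/(_ + _)%N addn1 ltnS.
Qed.
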